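(* Both of the recurrences $$C(n)=C(n-C(n-1))+C(n-1-C(n-2))\quad(n\ge 3),\qquad C(1)=1,\ C(2)=2,$$ and $$H(n)=H(n-H(n-2))+H(n-3-H(n-5))\quad(n\ge 6),\qquad H(1)=1,\ H(2)=H(3)=2,\ H(4)=3,\ H(5)=4,$$ have the Conolly sequence as their (well-defined) solution.
   Context: The ruler function $r_m$ ($m\ge1$) is $1$ plus the exponent of $2$ in the prime factorization of $m$. The Conolly sequence is the nondecreasing sequence of positive integers in which each positive integer $m$ occurs exactly $r_m$ times: $1,2,2,3,4,4,4,5,6,6,7,8,8,8,8,9,\dots$. *)

(* Defs.v *)
From mathcomp Require Import all_boot.

Set Implicit Arguments.
Unset Strict Implicit.
Unset Printing Implicit Defensive.

(* All sequences below are indexed by the integers n >= 1. They are encoded as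
   functions nat -> nat whose value at 0 is irrelevant: [agree] ignores it. *)
Definition agree (f g : nat -> nat) : Prop := forall n, 0 < n -> f n = g n.

Definition ruler (m : nat) : nat := (logn 2 m).+1.

Definition occurs_times (c : nat -> nat) (m k : nat) : Prop :=
  exists s : seq nat,
    [/\ uniq s, size s = k & forall n, n \in s <-> 0 < n /\ c n = m].

Definition conolly (c : nat -> nat) : Prop :=
  [/\ forall n, 0 < n -> 0 < c n,
      forall i j, 0 < i -> i <= j -> c i <= c j
    & forall m, 0 < m -> occurs_times c m (ruler m)].

(* The index k refers to a term that precedes the n-th one. Subtraction on nat
   is truncated, so an index n - a - b with n <= a + b evaluates to 0 and is
   rejected: [earlier n (n - a - b)] says that the integer n - a - b lies
   between 1 and n - 1. *)
Definition earlier (n k : nat) : Prop := 0 < k < n.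

Definition C_recurrence (f : nat -> nat) : Prop :=
  [/\ f 1 = 1, f 2 = 2
    & forall n, 3 <= n -> f n = f (n - f (n - 1)) + f (n - 1 - f (n - 2))].

Definition C_well_defined (f : nat -> nat) : Prop :=
  forall n, 3 <= n ->
    earlier n (n - f (n - 1)) /\ earlier n (n - 1 - f (n - 2)).

Definition H_recurrence (f : nat -> nat) : Prop :=
  [/\ f 1 = 1, f 2 = 2 /\ f 3 = 2, f 4 = 3, f 5 = 4
    & forall n, 6 <= n -> f n = f (n - f (n - 2)) + f (n - 3 - f (n - 5))].

Definition H_well_defined (f : nat -> nat) : Prop :=
  forall n, 6 <= n ->
    earlier n (n - f (n - 2)) /\ earlier n (n - 3 - f (n - 5)).

(* Every term of f is determined by earlier ones; hence f is also the only
   solution, which is stated explicitly. *)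
Definition well_defined_solution (recurrence well_defined : (nat -> nat) -> Prop)
    (f : nat -> nat) : Prop :=
  [/\ recurrence f, well_defined f & forall g, recurrence g -> agree g f].

(* Main.v *)
Require Import Defs.
From mathcomp Require Import all_boot.
From mathcomp Require Import zify.

(** Let [ruler_sum m] be the sum of the first [m] ruler values, that is, the last
    position at which the Conolly sequence [c] equals [m]; thus [c n <= m] iff
    [n <= ruler_sum m]. Since [r_{2k} = r_k + 1] and [r_{2k+1} = 1], we get
    [ruler_sum (2k) = 2k + ruler_sum k] and
    [ruler_sum (2k+1) = 2k + 1 + ruler_sum k]: subtracting a value near [2k] from
    a position near [ruler_sum (2k)] yields a position near [ruler_sum k], where
    [c] is about [k]. Locating both indices of a recurrence in this way shows that
    their values add up to [c n]. *)

(** * Ruler values and their partial sums *)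

Lemma ruler_odd k : ruler k.*2.+1 = 1.
Proof. by rewrite /ruler lognE /= dvdn2 /= odd_double. Qed.

Lemma ruler_double k : ruler k.+1.*2 = (ruler k.+1).+1.
Proof. by rewrite /ruler -muln2 lognM // (logn_prime 2 (isT : prime 2)) addn1. Qed.

Definition ruler_sum (m : nat) : nat := \sum_(i < m) ruler i.+1.

Lemma ruler_sumS m : ruler_sum m.+1 = ruler_sum m + ruler m.+1.
Proof. by rewrite /ruler_sum big_ord_recr. Qed.

Lemma ruler_sum_ltS m : ruler_sum m < ruler_sum m.+1.
Proof. by rewrite ruler_sumS /ruler; lia. Qed.

Lemma ruler_sum_double k : ruler_sum k.*2 = k.*2 + ruler_sum k.
Proof.
elim: k => [|k IHk]; first by rewrite /ruler_sum !big_ord0.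
rewrite doubleS !ruler_sumS IHk ruler_odd -doubleS ruler_double; lia.
Qed.

Lemma ruler_sum_doubleS k : ruler_sum k.*2.+1 = k.*2.+1 + ruler_sum k.
Proof. by rewrite ruler_sumS ruler_odd ruler_sum_double; lia. Qed.

(* Of two consecutive ruler values, the one at the odd index is 1 and the other is
   at least 2. *)
Lemma ruler_sumSS m :
  ruler_sum m.+1 = (ruler_sum m).+1 /\ (ruler_sum m.+1).+1 < ruler_sum m.+2 \/
  (ruler_sum m).+1 < ruler_sum m.+1 /\ ruler_sum m.+2 = (ruler_sum m.+1).+1.
Proof.
have ruler_gt1 k : 1 < ruler k.*2.+2 by rewrite -doubleS ruler_double.
rewrite !ruler_sumS; have := odd_double_half m; case: (odd m) => <-.
  by right; have := ruler_gt1 m./2; rewrite add1n -doubleS ruler_odd doubleS; lia.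
by left; have := ruler_gt1 m./2; rewrite add0n ruler_odd; lia.
Qed.

Lemma ruler_sum_small :
  [/\ ruler_sum 0 = 0, ruler_sum 1 = 1, ruler_sum 2 = 3, ruler_sum 3 = 4
    & ruler_sum 4 = 7].
Proof. by rewrite !ruler_sumS /ruler_sum big_ord0. Qed.

Lemma leq_ruler_sum : {mono ruler_sum : m n / m <= n}.
Proof. by apply/leq_mono/(homo_ltn ltn_trans)/ruler_sum_ltS. Qed.

(** * The Conolly sequence as the generalized inverse of [ruler_sum] *)

Lemma ruler_sum_ge m : m <= ruler_sum m.
Proof. by elim: m => // m IHm; apply: leq_ltn_trans (ruler_sum_ltS m). Qed.

Lemma ruler_sum_unbounded n : exists m, n <= ruler_sum m.
Proof. by exists n; apply: ruler_sum_ge. Qed.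

Definition conolly_seq (n : nat) : nat := ex_minn (ruler_sum_unbounded n).

Lemma conolly_seq_leq n m : (conolly_seq n <= m) = (n <= ruler_sum m).
Proof.
rewrite /conolly_seq; case: ex_minnP => v le_n min_v.
apply/idP/idP => [|/min_v //]; rewrite -leq_ruler_sum; exact: leq_trans.
Qed.

Lemma conolly_seq_eqS n m :
  (conolly_seq n == m.+1) = (ruler_sum m < n <= ruler_sum m.+1).
Proof. by rewrite eqn_leq conolly_seq_leq ltnNge conolly_seq_leq -ltnNge andbC. Qed.

Lemma conolly_seqE n m :
  ruler_sum m < n <= ruler_sum m.+1 -> conolly_seq n = m.+1.
Proof. by rewrite -conolly_seq_eqS => /eqP. Qed.

Lemma conolly_seq_gt0 n : 0 < n -> 0 < conolly_seq n.
Proof. by rewrite !ltnNge conolly_seq_leq /ruler_sum big_ord0. Qed.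

Lemma conolly_seq_le n : conolly_seq n <= n.
Proof. by rewrite conolly_seq_leq ruler_sum_ge. Qed.

Lemma conolly_seq_conolly : conolly conolly_seq.
Proof.
split=> [|i j _ le_ij|[//|m] _]; first exact: conolly_seq_gt0.
  by rewrite conolly_seq_leq (leq_trans le_ij) // -conolly_seq_leq.
exists (iota (ruler_sum m).+1 (ruler m.+1)).
rewrite iota_uniq size_iota; split=> // n.
have := conolly_seq_eqS n m; rewrite mem_iota ruler_sumS addSn ltnS => <-.
split=> [/eqP eq_n|[_ ->] //]; split=> //.
(* Index 0 has value 0, so it is not an occurrence of [m.+1]. *)
by have := conolly_seq_le n; case: n eq_n => // eq_0; rewrite eq_0.
Qed.

(** By induction on [m], the occurrences of [m.+1] start right after [ruler_sum m]; monotonicity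
    makes them contiguous, and counting them locates the end of the block. *)
Lemma conolly_leq (c : nat -> nat) m n :
  conolly c -> 0 < n -> (c n <= m) = (n <= ruler_sum m).
Proof.
move=> [c_gt0 c_mono c_occ]; elim: m n => [|m IHm] n n_gt0.
  by rewrite /ruler_sum big_ord0 leqNgt c_gt0 // leqNgt n_gt0.
have [s [s_uniq s_size s_mem]] := c_occ m.+1 isT.
have s_gt i : i \in s -> ruler_sum m < i.
  by move=> /s_mem[i_gt0 ci]; rewrite ltnNge -IHm // ci ltnn.
have s_down i j : ruler_sum m < i -> i <= j -> c j <= m.+1 -> i \in s.
  move=> lt_i le_ij cj; have i_gt0 : 0 < i by lia.
  apply/s_mem; split=> //; have := c_mono i j i_gt0 le_ij.
  have := IHm i i_gt0; lia.
rewrite ruler_sumS; apply/idP/idP => [cn|le_n].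
  (* Every position after [ruler_sum m] up to [n] carries [m.+1], so there are at most [ruler m.+1]
     of them. *)
  have sub (i : nat) : i \in iota (ruler_sum m).+1 (n - ruler_sum m) -> i \in s.
    by rewrite mem_iota => ?; apply: (s_down i n) => //; lia.
  have := uniq_leq_size (iota_uniq _ _) sub; rewrite s_size size_iota; lia.
rewrite leqNgt; apply/negP => cn.
have lt_n : ruler_sum m < n by have := IHm n n_gt0; lia.
(* If [c n] exceeds [m.+1], all occurrences of [m.+1] lie strictly before [n], which leaves too
   little room for them. *)
have sub (i : nat) : i \in s -> i \in iota (ruler_sum m).+1 (n - ruler_sum m).-1.
  move=> s_i; have := s_gt i s_i; rewrite mem_iota.
  have [_ ci] := (s_mem i).1 s_i.
  have [le_ni|] := leqP n i; last by lia.
  by have := c_mono n i n_gt0 le_ni; lia.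
have := uniq_leq_size s_uniq sub; rewrite s_size size_iota; lia.
Qed.

Lemma conolly_unique (c : nat -> nat) : conolly c -> agree c conolly_seq.
Proof.
move=> c_conolly n n_gt0; apply/eqP; rewrite eqn_leq conolly_seq_leq.
have leE k := conolly_leq c k n c_conolly n_gt0.
by rewrite leE -conolly_seq_leq -leE !leqnn.
Qed.

(** * Verification of the two recurrences *)

Lemma conolly_seq_small :
  [/\ conolly_seq 1 = 1, conolly_seq 2 = 2, conolly_seq 3 = 2,
      conolly_seq 4 = 3 & conolly_seq 5 = 4].
Proof.
have [S0 S1 S2 S3 S4] := ruler_sum_small.
by split; apply: conolly_seqE; rewrite ?S0 ?S1 ?S2 ?S3 ?S4.
Qed.

Lemma conolly_seq_block n : 0 < n ->
  exists2 m, ruler_sum m < n <= ruler_sum m.+1 & conolly_seq n = m.+1.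
Proof.
move=> /conolly_seq_gt0/prednK eq_n.
by exists (conolly_seq n).-1; rewrite -?conolly_seq_eqS eq_n.
Qed.

(** Rewriting with [doubleS] brings the arguments of [ruler_sum] to a common form, so that [lia]
    sees equal terms as the same atom. *)
Ltac ruler_sum_facts k :=
  have := ruler_sum_double k; have := ruler_sum_doubleS k;
  have := ruler_sum_ltS k; have := ruler_sumSS k; rewrite ?doubleS.

(* The value substituted for [conolly_seq i] is [v.+1], not [v]. *)
Ltac conolly_at i v := rewrite (conolly_seqE i v); last lia.

Lemma conolly_seq_C n : 3 <= n ->
  conolly_seq n = conolly_seq (n - conolly_seq (n - 1)) +
                  conolly_seq (n - 1 - conolly_seq (n - 2)).
Proof.
move=> n_ge3; have [|m /andP[lo hi] ->] := conolly_seq_block n; first lia.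
have [S0 S1 S2 S3 S4] := ruler_sum_small.
have [k [Em|Em]] : exists k, m = k.*2 \/ m = k.*2.+1 by exists m./2; lia.
  case: k => [|p] in Em; first by rewrite Em double0 in hi; lia.
  rewrite {m}Em !doubleS in lo hi *; ruler_sum_facts p; ruler_sum_facts p.+1 => *.
  (* The odd value [p.*2.+3] occurs only at [n], and at least two copies of [p.*2.+2] precede it. *)
  conolly_at (n - 1) p.*2.+1; conolly_at (n - 2) p.*2.+1.
  conolly_at (n - p.*2.+2) p.+1; conolly_at (n - 1 - p.*2.+2) p; lia.
case: k => [|p] in Em.
  have -> : n = 3 by rewrite Em double0 in hi; lia.
  have [c1 c2 _ _ _] := conolly_seq_small.
  by rewrite Em !(subn1, subn2) /= c1 c2 /= c1.
rewrite {m}Em !doubleS in lo hi *.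
have [j Ej] : exists j, n = ruler_sum p.*2.+3 + j.+1.
  by exists (n - (ruler_sum p.*2.+3).+1); lia.
ruler_sum_facts p; ruler_sum_facts p.+1; ruler_sum_facts p.+2 => *.
(* [j] counts the preceding occurrences of the value [c n = p.*2.+4]. *)
case: j => [|[|j]] in Ej.
- conolly_at (n - 1) p.*2.+2; conolly_at (n - 2) p.*2.+1.
  conolly_at (n - p.*2.+3) p.+1; conolly_at (n - 1 - p.*2.+2) p.+1; lia.
- conolly_at (n - 1) p.*2.+3; conolly_at (n - 2) p.*2.+2.
  conolly_at (n - p.*2.+4) p.+1; conolly_at (n - 1 - p.*2.+3) p.+1; lia.
- conolly_at (n - 1) p.*2.+3; conolly_at (n - 2) p.*2.+3.
  conolly_at (n - p.*2.+4) p.+1; conolly_at (n - 1 - p.*2.+4) p.+1; lia.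
Qed.

Lemma conolly_seq_H n : 6 <= n ->
  conolly_seq n = conolly_seq (n - conolly_seq (n - 2)) +
                  conolly_seq (n - 3 - conolly_seq (n - 5)).
Proof.
move=> n_ge6; have [|m /andP[lo hi] ->] := conolly_seq_block n; first lia.
have [S0 S1 S2 S3 S4] := ruler_sum_small.
have [k [Em|Em]] : exists k, m = k.*2 \/ m = k.*2.+1 by exists m./2; lia.
  case: k => [|[|q]] in Em; try by rewrite Em ?doubleS double0 in hi; lia.
  rewrite {m}Em !doubleS in lo hi *.
  ruler_sum_facts q; ruler_sum_facts q.+1; ruler_sum_facts q.+2 => *.
  conolly_at (n - 2) q.*2.+3; conolly_at (n - q.*2.+4) q.+2.
  (* Split on whether the value [q.+2] occurs at least 3, at least 4 times. *)
  have [r3|r3] := leqP (ruler_sum q.+1 + 3) (ruler_sum q.+2).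
    have [r4|r4] := leqP (ruler_sum q.+1 + 4) (ruler_sum q.+2).
      conolly_at (n - 5) q.*2.+3; conolly_at (n - 3 - q.*2.+4) q.+1; lia.
    conolly_at (n - 5) q.*2.+2; conolly_at (n - 3 - q.*2.+3) q.+1; lia.
  conolly_at (n - 5) q.*2.+1; conolly_at (n - 3 - q.*2.+2) q.+1; lia.
case: k => [|p] in Em; first by rewrite Em double0 in hi; lia.
rewrite {m}Em !doubleS in lo hi *.
have [j Ej] : exists j, n = ruler_sum p.*2.+3 + j.+1.
  by exists (n - (ruler_sum p.*2.+3).+1); lia.
ruler_sum_facts p; ruler_sum_facts p.+1; ruler_sum_facts p.+2 => *.
(* As for the first recurrence, [j] counts earlier occurrences of [c n]; once there are five,
   [n - 5] lies in the same block. *)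
case: j => [|[|[|[|[|j]]]]] in Ej.
- conolly_at (n - 2) p.*2.+1.
  (* The first index, [n - p.*2.+2], equals [ruler_sum p.+1 + 2]: its value is [p.+3] if [p.+2]
     occurs only once, and [p.+2] otherwise. *)
  have [r1|r2] := leqP (ruler_sum p.+2) (ruler_sum p.+1 + 1).
    conolly_at (n - p.*2.+2) p.+2.
    have [r2|r3] := leqP (ruler_sum p.+1) (ruler_sum p + 2).
      conolly_at (n - 5) p.*2; conolly_at (n - 3 - p.*2.+1) p; lia.
    conolly_at (n - 5) p.*2.+1; conolly_at (n - 3 - p.*2.+2) p; lia.
  conolly_at (n - p.*2.+2) p.+1.
  (* Now [p.+1] is odd, so [p.*2.+2] occurs just twice and [n - 5] has value [p.*2]. For [p = 0]
     this would be [n = 5], below the range. *)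
  destruct p as [|q]; first by rewrite double0 in Ej; lia.
  rewrite !doubleS in lo hi Ej *.
  ruler_sum_facts q; ruler_sum_facts q.+1; ruler_sum_facts q.+2 => *.
  conolly_at (n - 5) q.*2.+1; conolly_at (n - 3 - q.*2.+2) q.+2; lia.
- conolly_at (n - 2) p.*2.+2.
  have [r1|r2] := leqP (ruler_sum p.+2) (ruler_sum p.+1 + 1).
    conolly_at (n - p.*2.+3) p.+2.
    conolly_at (n - 5) p.*2.+1; conolly_at (n - 3 - p.*2.+2) p; lia.
  conolly_at (n - p.*2.+3) p.+1.
  conolly_at (n - 5) p.*2; conolly_at (n - 3 - p.*2.+1) p.+1; lia.
- conolly_at (n - 2) p.*2.+3; conolly_at (n - p.*2.+4) p.+1.
  conolly_at (n - 5) p.*2.+1; conolly_at (n - 3 - p.*2.+2) p.+1; lia.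
- conolly_at (n - 2) p.*2.+3; conolly_at (n - p.*2.+4) p.+1.
  conolly_at (n - 5) p.*2.+1; conolly_at (n - 3 - p.*2.+2) p.+1; lia.
- conolly_at (n - 2) p.*2.+3; conolly_at (n - p.*2.+4) p.+1.
  conolly_at (n - 5) p.*2.+2; conolly_at (n - 3 - p.*2.+3) p.+1; lia.
- conolly_at (n - 2) p.*2.+3; conolly_at (n - p.*2.+4) p.+1.
  conolly_at (n - 5) p.*2.+3; conolly_at (n - 3 - p.*2.+4) p.+1; lia.
Qed.

(** The indices are legitimate because [0 < conolly_seq k <= k] for positive [k]; uniqueness then
    follows by strong induction. The same argument serves for [H]. *)
Lemma conolly_seq_C_solution :
  well_defined_solution C_recurrence C_well_defined conolly_seq.
Proof.
have [c1 c2 c3 c4 c5] := conolly_seq_small.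
have wd : C_well_defined conolly_seq.
  move=> n n_ge3; rewrite /earlier.
  have := (conolly_seq_le (n - 1), conolly_seq_le (n - 2)) => -[].
  have : 0 < conolly_seq (n - 1) by apply: conolly_seq_gt0; lia.
  lia.
split=> // [|g [g1 g2 gE]]; first by split=> //; apply: conolly_seq_C.
elim/ltn_ind=> n IHn n_gt0.
have [n_ge3|] := leqP 3 n; last by case: n n_gt0 IHn => [|[|[|]]] //= *; congruence.
have [/andP[? ?] /andP[? ?]] := wd n n_ge3.
rewrite gE // conolly_seq_C // (IHn (n - 1)) ?(IHn (n - 2)) ?IHn //; lia.
Qed.

Lemma conolly_seq_H_solution :
  well_defined_solution H_recurrence H_well_defined conolly_seq.
Proof.
have [c1 c2 c3 c4 c5] := conolly_seq_small.
have wd : H_well_defined conolly_seq.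
  move=> n n_ge6; rewrite /earlier.
  have := (conolly_seq_le (n - 2), conolly_seq_le (n - 5)) => -[].
  have : 0 < conolly_seq (n - 2) by apply: conolly_seq_gt0; lia.
  lia.
split=> // [|g [g1 [g2 g3] g4 g5 gE]]; first by split=> //; apply: conolly_seq_H.
elim/ltn_ind=> n IHn n_gt0.
have [n_ge6|] := leqP 6 n.
  have [/andP[? ?] /andP[? ?]] := wd n n_ge6.
  rewrite gE // conolly_seq_H // (IHn (n - 2)) ?(IHn (n - 5)) ?IHn //; lia.
by case: n n_gt0 IHn => [|[|[|[|[|[|]]]]]] //= *; congruence.
Qed.

Theorem theorem3p1 :
  exists c : nat -> nat,
    [/\ conolly c,
        forall c' : nat -> nat, conolly c' -> agree c' c,
        well_defined_solution C_recurrence C_well_defined c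
      & well_defined_solution H_recurrence H_well_defined c].
Proof.
exists conolly_seq; split.
- exact: conolly_seq_conolly.
- exact: conolly_unique.
- exact: conolly_seq_C_solution.
- exact: conolly_seq_H_solution.
Qed.
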